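(* Let $n\in\mathbb N$ and let $c$ be a nonzero real number. Let $f$ be a well defined $n$-th tropical meromorphic function on $\mathbb R$ with hyper-order $$\rho_2(f)=:\rho_2<1,$$ and let $\sigma\in(0,1-\rho_2)$. Then $$m\big(r,f(x+c)\oslash f(x)\big)=o\left(\frac{T(r,f)}{r^{\sigma}}\right)$$ as $r$ tends to infinity outside of a set of finite logarithmic measure.
   Context: $\mathbb N=\{1,2,\dots\}$. For $n\in\mathbb N$, an $n$-th tropical meromorphic function is a continuous function $f:\mathbb R\to\mathbb R$ for which there is an increasing sequence of breakpoints $\{x_i\}$ without finite accumulation point such that on each $[x_{i-1},x_i]$ $f$ equals a polynomial of degree $n_i$, with $\sup_i n_i=n$ (in particular $f$ is non-constant). A polynomial $p$ of degree $k\ge1$ is called well defined if $p(x)-p(0)=\sum_{j=1}^m a_{2j-1}x^{2j-1}$ when $k=2m-1$, and $p(x)-p(0)=\sum_{j=1}^m a_{2j}x^{2j}$ when $k=2m$, where the coefficients are either all non-negative or all non-positive; constants also count as well defined. An $n$-th tropical meromorphic function is well defined if it is a well defined polynomial on each of its segments. $a\oslash b$ means $a-b$, so $f(x+c)\oslash f(x)$ is the function $x\mapsto f(x+c)-f(x)$. Sign convention: $\operatorname{sgn}(x^{\pm})=\operatorname{sgn}(x)$ for $x\ne0$ and $\operatorname{sgn}(0^{\pm})=\pm1$. For $1\le j\le n$, $\omega_f^{(j)}(x)=\frac{1}{j!}\left(\operatorname{sgn}^{j+1}(x^+)f^{(j)}(x^+)-\operatorname{sgn}^{j+1}(x^-)f^{(j)}(x^-)\right)$,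 with one-sided derivatives. A point $x$ is a $j$-th pole if $\omega_f^{(j)}(x)<0$. $m(r,f)=\frac12(f^+(r)+f^+(-r))$ with $f^+=\max\{f,0\}$; $N^{(j)}(r,f)=\frac12\sum_z|\omega_f^{(j)}(z)|(r-|z|)^j$, the sum running over all $j$-th poles $z$ of $f$ in $(-r,r)$; $T(r,f)=m(r,f)+\sum_{j=1}^nN^{(j)}(r,f)$. The hyper-order is $\rho_2(f)=\limsup_{r\to\infty}\frac{\log\log T(r,f)}{\log r}$. A set $E\subset(0,\infty)$ has finite logarithmic measure if $\int_{E\cap[1,\infty)}dr/r<\infty$. *)

(* Defs.v *)
From HB Require Import structures.
From mathcomp Require Import all_boot all_order all_algebra.
From mathcomp Require Import all_classical all_reals all_analysis.

Set Implicit Arguments.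
Unset Strict Implicit.
Unset Printing Implicit Defensive.

Import Order.TTheory GRing.Theory Num.Theory.
Import numFieldNormedType.Exports.

Local Open Scope classical_set_scope.
Local Open Scope ring_scope.

Definition degree (R : realType) (p : {poly R}) : nat := (size p).-1.

(* The breakpoints are indexed by all integers, so that the segments cover the
   line; a function with finitely many genuine breakpoints is covered because
   f is not required to change its polynomial at x i. *)
Definition tropical_segmentation (R : realType) (n : nat) (f : R -> R)
    (x : int -> R) (p : int -> {poly R}) : Prop :=
  [/\ {homo x : i j / i < j},
      forall a : R, ~ limit_point (range x) a,
      forall (i : int) (t : R), x (i - 1) <= t <= x i -> f t = (p i).[t],
      forall i : int, (degree (p i) <= n)%N
    & exists i : int, degree (p i) = n].

Definition tropical_meromorphic (R : realType) (n : nat) (f : R -> R) : Prop :=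
  continuous f /\
  exists (x : int -> R) (p : int -> {poly R}), tropical_segmentation n f x p.

(* The condition holds trivially for constants, whose coefficients of positive
   index all vanish. *)
Definition well_defined_poly (R : realType) (p : {poly R}) : Prop :=
  (forall i : nat, (0 < i)%N -> odd i != odd (degree p) -> p`_i = 0) /\
  ((forall i : nat, (0 < i)%N -> 0 <= p`_i) \/
   (forall i : nat, (0 < i)%N -> p`_i <= 0)).

(* The polynomial on a nondegenerate segment is determined by f, so this does
   not depend on the chosen segmentation. *)
Definition well_defined_tropical (R : realType) (n : nat) (f : R -> R) : Prop :=
  exists (x : int -> R) (p : int -> {poly R}),
    tropical_segmentation n f x p /\ forall i : int, well_defined_poly (p i).

Definition sgn_right (R : realType) (x : R) : R :=
  if x == 0 then 1 else Num.sg x.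

Definition sgn_left (R : realType) (x : R) : R :=
  if x == 0 then -1 else Num.sg x.

Definition deriv_right (R : realType) (f : R -> R) (j : nat) (x : R) : R :=
  lim (derive1n j f y @[y --> x^'+]).

Definition deriv_left (R : realType) (f : R -> R) (j : nat) (x : R) : R :=
  lim (derive1n j f y @[y --> x^'-]).

Definition omega (R : realType) (f : R -> R) (j : nat) (x : R) : R :=
  (j`!%:R)^-1 * (sgn_right x ^+ j.+1 * deriv_right f j x
                 - sgn_left x ^+ j.+1 * deriv_left f j x).

Definition is_pole (R : realType) (f : R -> R) (j : nat) (x : R) : Prop :=
  omega f j x < 0.

Definition proximity (R : realType) (f : R -> R) (r : R) : R :=
  2^-1 * (Num.max (f r) 0 + Num.max (f (- r)) 0).

(* The sum is a finitely supported one: the poles of a tropical meromorphic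
   function lie among 0 and the breakpoints. *)
Definition counting_fun (R : realType) (f : R -> R) (j : nat) (r : R) : R :=
  2^-1 * \sum_(z \in [set z : R | - r < z < r /\ is_pole f j z])
           (`|omega f j z| * (r - `|z|) ^+ j).

Definition characteristic (R : realType) (n : nat) (f : R -> R) (r : R) : R :=
  proximity f r + \sum_(1 <= j < n.+1) counting_fun f j r.

(* The library's ln vanishes on nonpositive reals; since T(r,f) tends to
   infinity for a well defined f, only values > 1 matter in the limsup. *)
Definition hyper_order (R : realType) (n : nat) (f : R -> R) : \bar R :=
  limf_esup (fun r : R => (ln (ln (characteristic n f r)) / ln r)%:E)
            (pinfty_nbhs R).

Definition finite_log_measure (R : realType) (E : set R) : Prop :=
  [/\ measurable E, E `<=` `]0, +oo[
    & (\int[lebesgue_measure]_(r in E `&` `[1%R, +oo[) (r^-1)%:E < +oo)%E].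

(* Lets the little-o notation be used along +oo and along restrictions of it;
   the library declares no bundled filter for pinfty_nbhs. *)
Canonical pinfty_nbhs_filter_on (R : numFieldType) :=
  FilterType (pinfty_nbhs R) (@filter_filter _ _ _).

(* Main.v *)
(* On each half line, writing f(t) and f(-t) (t >= 0) as a sum of truncated
   powers (t - z)_+^j, the coefficients at z > 0 are the jumps
   [omega f j (+-z)].  Hence f is dominated, increment by increment, by the
   function S obtained by replacing all coefficients by their absolute values.
   Since |w| = w + 2 max(-w, 0), S differs from 4 times the sum of the counting
   functions only by f(t) + f(-t) and the pieces at the origin, and
   well-definedness bounds the latter; so S <= C (T + 1).  Thus
   m(r, f(x+c) - f(x)) <= S(r+|c|) - S(r-|c|).  As ln S(r) = O(r^rho') with
   rho' < 1 - sigma, the increments of ln S over windows of length 2|c| can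
   exceed r^(-s), sigma < s < 1 - rho', only on a set of finite logarithmic
   measure: there dr/r is controlled by the decrease of the bounded function
   (ln S)^(-d), where d = (1 - s)/rho' - 1 > 0. *)

Require Import Defs.
From HB Require Import structures.
From mathcomp Require Import all_boot all_order all_algebra.
From mathcomp Require Import all_classical all_reals all_analysis.
From mathcomp Require Import measurable_realfun.
From mathcomp Require Import ring lra zify.

Import Order.TTheory GRing.Theory Num.Theory.
Import numFieldNormedType.Exports.

Local Open Scope classical_set_scope.
Local Open Scope ring_scope.

Set Implicit Arguments.
Unset Strict Implicit.
Unset Printing Implicit Defensive.

(** * One-sided derivatives and jumps *)

Lemma derive1n_poly (R : realType) (f : R -> R) (p : {poly R}) (a b : R)
    (j : nat) :
  {in `]a, b[, f =1 horner p} -> {in `]a, b[, derive1n j f =1 horner p^`(j)}.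
Proof.
move=> fp; elim: j => [//|j IH] t tab.
rewrite derive1nS derivnS derivE !derive1E; apply: near_eq_derive.
by near=> u; apply: IH; near: u; exact: near_in_itvoo.
Unshelve. all: by end_near. Qed.

(** [deriv_right] is a limit of two-sided derivatives at points to the right of [z], so agreement
    with [p] on an open interval determines it even when [z] is the left endpoint. *)
Lemma deriv_right_poly (R : realType) (f : R -> R) (p : {poly R}) (a b z : R)
    (j : nat) :
  {in `]a, b[, f =1 horner p} -> a <= z < b -> deriv_right f j z = p^`(j).[z].
Proof.
move=> fp /andP[az zb]; apply: cvg_lim => //.
have : horner p^`(j) y @[y --> z^'+] --> p^`(j).[z].
  exact/cvg_at_right_filter/continuous_horner.
apply: cvg_trans; apply: near_eq_cvg; near=> y.
rewrite (@derive1n_poly _ f p a b)// in_itv/=; apply/andP; split; near: y.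
  by near=> y; apply: le_lt_trans az _; near: y; exact: nbhs_right_gt.
exact: nbhs_right_lt.
Unshelve. all: by end_near. Qed.

Lemma deriv_left_poly (R : realType) (f : R -> R) (p : {poly R}) (a b z : R)
    (j : nat) :
  {in `]a, b[, f =1 horner p} -> a < z <= b -> deriv_left f j z = p^`(j).[z].
Proof.
move=> fp /andP[az zb]; apply: cvg_lim => //.
have : horner p^`(j) y @[y --> z^'-] --> p^`(j).[z].
  exact/cvg_at_left_filter/continuous_horner.
apply: cvg_trans; apply: near_eq_cvg; near=> y.
rewrite (@derive1n_poly _ f p a b)// in_itv/=; apply/andP; split; near: y.
  exact: nbhs_left_gt.
by near=> y; apply: lt_le_trans _ zb; near: y; exact: nbhs_left_lt.
Unshelve. all: by end_near. Qed.

Lemma derivn_compN (R : realType) (p : {poly R}) (j : nat) (z : R) :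
  (p \Po - 'X)^`(j).[z] = (-1) ^+ j * p^`(j).[- z].
Proof.
suff -> : (p \Po - 'X)^`(j) = (-1) ^+ j *: (p^`(j) \Po - 'X).
  by rewrite !hornerE horner_comp !hornerE.
elim: j => [|j IH]; first by rewrite expr0 scale1r.
rewrite derivnS IH derivZ deriv_comp derivN derivX -derivnS exprS mulN1r.
by rewrite scaleNr mulrN1 scalerN.
Qed.

Lemma nderivn_horner (R : realType) (p : {poly R}) (j : nat) (z : R) :
  (j`!%:R)^-1 * p^`(j).[z] = p^`N(j).[z].
Proof.
by rewrite nderivn_def hornerMn -[X in _ * X]mulr_natl mulKf.
Qed.

Lemma polyN_itv (R : realType) (f : R -> R) (p : {poly R}) (a b : R) :
  {in `]a, b[, f \o -%R =1 horner p} ->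
  {in `]- b, - a[, f =1 horner (p \Po - 'X)}.
Proof.
move=> fp t; rewrite in_itv/= => /andP[bt ta].
have := fp (- t); rewrite /= opprK horner_comp !hornerE => -> //.
by rewrite in_itv/=; lra.
Qed.

Lemma omega_pos (R : realType) (f : R -> R) (p q : {poly R}) (a z b : R)
    (j : nat) : 0 <= a -> a < z < b ->
  {in `]a, z[, f =1 horner p} -> {in `]z, b[, f =1 horner q} ->
  omega f j z = (q - p)^`N(j).[z].
Proof.
move=> a0 /andP[az zb] fp fq; have z0 : 0 < z by lra.
rewrite /omega /sgn_right /sgn_left gt_eqF// gtr0_sg// !expr1n !mul1r.
rewrite (deriv_right_poly _ fq) ?lexx// (deriv_left_poly _ fp) ?az ?lexx//.
by rewrite mulrBr !nderivn_horner linearB hornerD hornerN.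
Qed.

(** Reflection puts a factor (-1)^j on the [j]-th derivative, and the sign convention at a negative
    point gives (-1)^(j+1). The remaining -1 makes up for reflection exchanging the two sides. *)
Lemma omega_neg (R : realType) (f : R -> R) (p q : {poly R}) (a z b : R)
    (j : nat) : 0 <= a -> a < z < b ->
  {in `]a, z[, f \o -%R =1 horner p} -> {in `]z, b[, f \o -%R =1 horner q} ->
  omega f j (- z) = (q - p)^`N(j).[z].
Proof.
move=> a0 /andP[az zb] /polyN_itv fp /polyN_itv fq; have z0 : 0 < z by lra.
rewrite /omega /sgn_right /sgn_left oppr_eq0 gt_eqF// ltr0_sg ?oppr_lt0//.
rewrite (deriv_right_poly _ fp) ?lexx ?ltrN2//.
rewrite (deriv_left_poly _ fq) ?lexx ?ltrN2 ?zb//.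
rewrite !derivn_compN !opprK !mulrA -!exprD addSn addnn exprS.
rewrite -mul2n exprM sqrrN expr1n expr1n mulr1 !mulN1r opprK addrC mulrBr.
by rewrite !nderivn_horner linearB hornerD hornerN.
Qed.

(** With sign 1 on the right of 0 and (-1)^(j+1) on the left, both half lines, read outwards from
    the origin, contribute with a plus sign. *)
Lemma omega_zero (R : realType) (f : R -> R) (p q : {poly R}) (a b : R)
    (j : nat) : 0 < a -> 0 < b ->
  {in `]0, a[, f =1 horner p} -> {in `]0, b[, f \o -%R =1 horner q} ->
  omega f j 0 = p`_j + q`_j.
Proof.
move=> a0 b0 fp /polyN_itv fq.
rewrite /omega /sgn_right /sgn_left eqxx expr1n.
rewrite (deriv_right_poly _ fp) ?lexx//.
rewrite (deriv_left_poly _ fq) ?oppr0 ?lexx ?oppr_lt0 ?b0//.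
rewrite derivn_compN oppr0 mulrA -exprD addSn addnn exprS.
rewrite -mul2n exprM sqrrN expr1n expr1n mulr1 mulN1r opprK mul1r mulrDr.
by rewrite !nderivn_horner !horner_coef0 !coef_nderivn !addn0 !binn.
Qed.

(** * Segmentations and half lines *)

(** Lets the negative half line be treated as a positive one. The segment from [- x (1 - i)] to
    [- x (- i)] reflects the one ending at [x (1 - i)], whence the piece [1 - i]. *)
Lemma segmentation_opp (R : realType) (n : nat) (f : R -> R)
    (x : int -> R) (p : int -> {poly R}) :
  tropical_segmentation n f x p ->
  tropical_segmentation n (f \o -%R) (fun i => - x (- i))
    (fun i => p (1 - i) \Po - 'X).
Proof.
have szN (r : {poly R}) : degree (r \Po - 'X) = degree r.
  by rewrite /degree size_comp_poly2// size_polyN size_polyX.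
move=> [xlt xacc fp dp [i di]]; split.
- by move=> j k jk; rewrite ltrN2 xlt// ltrN2.
- move=> a /= la; apply: (xacc (- a)) => U Ua.
  have /la[z [za [j _ jz] Uz]] : nbhs a (-%R @^-1` U).
    by move: Ua; rewrite nbhsN.
  exists (- z); split => //; first by rewrite eqr_opp.
  by exists (- j) => //; rewrite -jz opprK.
- move=> j t /andP[jt tj] /=; rewrite horner_comp !hornerE (fp (1 - j))//.
  rewrite addrAC subrr add0r; apply/andP; split; first by rewrite lerNr.
  by rewrite lerNl -[X in x X]opprB.
- by move=> j; rewrite szN.
- by exists (1 - i); rewrite szN opprB addrC subrK.
Qed.

Lemma coef_compN (R : realType) (p : {poly R}) (i : nat) :
  (p \Po - 'X)`_i = (-1) ^+ i * p`_i.
Proof.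
have coefE (r : {poly R}) : r`_i = (i`!%:R)^-1 * r^`(i).[0].
  by rewrite nderivn_horner horner_coef0 coef_nderivn addn0 binn.
by rewrite !coefE derivn_compN oppr0 mulrCA.
Qed.

(** The nonzero coefficients of positive index all have the parity of the degree, so the
    substitution multiplies them by one common sign. *)
Lemma well_defined_polyN (R : realType) (p : {poly R}) :
  well_defined_poly p -> well_defined_poly (p \Po - 'X).
Proof.
rewrite /well_defined_poly /degree size_comp_poly2 ?size_polyN ?size_polyX//.
move=> [par sgn]; split.
  by move=> i i0 /(par i i0) p0; rewrite coef_compN p0 mulr0.
have coefE i : (0 < i)%N ->
    (p \Po - 'X)`_i = (-1) ^+ odd (size p).-1 * p`_i.
  move=> i0; rewrite coef_compN -signr_odd.
  have [->//|/(par i i0) ->] := eqVneq (odd i) (odd (size p).-1).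
  by rewrite !mulr0.
case: odd in coefE; case: sgn => sgn; [right|left|left|right] => i i0;
  rewrite coefE// ?mul1r ?mulN1r ?oppr_le0 ?oppr_ge0; exact: sgn.
Qed.

(** If the breakpoints to the right were bounded, their supremum would be an accumulation point. *)
Lemma segmentation_unbounded (R : realType) (n : nat) (f : R -> R)
    (x : int -> R) (p : int -> {poly R}) :
  tropical_segmentation n f x p -> forall M : R, exists k : nat, M < x k%:Z.
Proof.
move=> [xlt xacc _ _ _] M; apply: contrapT => /forallNP xM.
pose A := [set x k%:Z | k in [set: nat]].
have Asup : has_sup A.
  split; first by exists (x 0%:Z), 0%N.
  by exists M => _ [k _ <-]; rewrite leNgt; apply/negP/xM.
apply: (xacc (sup A)) => U; rewrite -nbhs_ballE => -[e /= e0 eU].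
have [_ [k _ <-] kA] := sup_adherent e0 Asup.
have xk : x k%:Z < x k.+1%:Z by apply: xlt; lia.
have xA : x k.+1%:Z <= sup A by apply: sup_upper_bound => //; exists k.+1.
exists (x k%:Z); split; [by rewrite lt_eqF// (lt_le_trans xk)| by exists k%:Z|].
by apply: eU; rewrite /ball /= ger0_norm; lra.
Qed.

Lemma segment_of_zero (R : realType) (n : nat) (f : R -> R)
    (x : int -> R) (p : int -> {poly R}) :
  tropical_segmentation n f x p -> exists i : int, x (i - 1) <= 0 < x i.
Proof.
move=> xp; have [m xm] := segmentation_unbounded (segmentation_opp xp) 0.
have [l xl] := segmentation_unbounded xp 0.
have [xlt _ _ _ _] := xp.
have xk : exists k : nat, 0 < x (k%:Z - m%:Z).
  by exists (l + m)%N; rewrite PoszD addrK.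
(* The choice of [m] gives [x (- m) < 0], so the least [k] is positive and minimality puts 0 in the
   segment ending there. *)
case: (ex_minnP xk) => -[|k] kP kmin.
  by rewrite add0r in kP; lra.
exists (k.+1%:Z - m%:Z); rewrite kP andbT leNgt; apply/negP.
have -> : k.+1%:Z - m%:Z - 1 = k%:Z - m%:Z by lia.
by move=> /kmin; rewrite ltnn.
Qed.

(** The origin is made a node whether or not it is a breakpoint, so that both half lines start
    there. *)
Definition half_pieces (R : realType) (n : nat) (h : R -> R) (y : nat -> R)
    (q : nat -> {poly R}) : Prop :=
  [/\ y 0%N = 0, {homo y : i j / (i < j)%N >-> i < j},
      forall M : R, exists k : nat, M < y k,
      forall (k : nat) (t : R), y k <= t <= y k.+1 -> h t = (q k).[t]
    & forall k : nat, (size (q k) <= n.+1)%N].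

Definition one_signed (R : realType) (p : {poly R}) : Prop :=
  (forall i : nat, (0 < i)%N -> 0 <= p`_i) \/
  (forall i : nat, (0 < i)%N -> p`_i <= 0).

Lemma segmentation_half (R : realType) (n : nat) (f : R -> R)
    (x : int -> R) (p : int -> {poly R}) :
  tropical_segmentation n f x p -> (forall i, well_defined_poly (p i)) ->
  exists (y : nat -> R) (q : nat -> {poly R}),
    half_pieces n f y q /\ one_signed (q 0%N).
Proof.
move=> xp wd; have [i0 /andP[xi xi0]] := segment_of_zero xp.
have xM := segmentation_unbounded xp; have [xlt _ fp dp _] := xp.
(* The segment containing 0 is cut at 0, which shifts the nodes by one against the pieces. *)
exists (fun k => if k is k'.+1 then x (i0 + k'%:Z) else 0),
  (fun k => p (i0 + k%:Z)); split; last by case: (wd (i0 + 0)).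
split => //.
- move=> [|j] [|k]//= jk; last by apply: xlt; lia.
  by apply: (lt_le_trans xi0); rewrite (ltW_homo (f := x))//; lia.
- move=> M; have [k xk] := xM M; exists (k + `|i0|)%N.+1.
  by apply: (lt_le_trans xk); rewrite (ltW_homo (f := x))//; lia.
- move=> [|k] t /andP[kt tk]; apply: fp; rewrite ?tk ?andbT.
    by rewrite addr0 (le_trans xi).
  by have -> : i0 + k.+1%:Z - 1 = i0 + k%:Z by lia.
- move=> k; have := dp (i0 + k%:Z); rewrite /degree; lia.
Qed.

(** On a piece of degree [n] the [n]-th derivative is the leading coefficient times a factorial,
    hence nonzero; for a constant function it would vanish. *)
Lemma segmentation_nonconstant (R : realType) (n : nat) (f : R -> R)
    (x : int -> R) (p : int -> {poly R}) : (0 < n)%N ->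
  tropical_segmentation n f x p -> exists t : R, f t != f 0.
Proof.
move=> n0 [xlt _ fp _ [i di]]; apply: contrapT => /forallNP fc.
have f0 t : f t = f 0 by apply/eqP/negPn/negP/fc.
have xi : x (i - 1) < x i by apply: xlt; lia.
have mid : (x (i - 1) + x i) / 2 \in `]x (i - 1), x i[ by rewrite in_itv/=; lra.
have pn t : (p i)^`(n).[t] = (p i)`_n *+ n`!.
  suff -> : (p i)^`(n) = ((p i)`_n *+ n`!)%:P by rewrite hornerC.
  apply/polyP => -[|k]; rewrite coef_derivn coefC/= ?addn0 ?ffactnn//.
  rewrite nth_default ?mul0rn//; move: di; rewrite /degree.
  by case: size => [|s] /=; lia.
have := @derive1n_poly _ f (p i) (x (i - 1)) (x i) n _ _ mid.
rewrite (@derive1n_poly _ f (f 0)%:P (x (i - 1)) (x i) n _ _ mid); last first.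
  by move=> t _; rewrite hornerC.
rewrite derivnC gtn_eqF// horner0 pn => /(_ _)/eqP; rewrite eq_sym mulrn_eq0.
rewrite gtn_eqF ?fact_gt0//= -di -lead_coefE lead_coef_eq0 => p0.
move: n0; rewrite -di /degree (eqP (p0 _)) ?size_poly0// => t tI.
by rewrite (fp i)// !ltW// (itvP tI).
Qed.

(** * Truncated power expansion and the majorant *)

(* The jump at [y 0 = 0] is measured from the zero polynomial, so it consists of
   the Taylor coefficients of the first piece. *)
Definition jump (R : realType) (y : nat -> R) (q : nat -> {poly R})
    (k j : nat) : R :=
  (q k - (if k is k'.+1 then q k' else 0))^`N(j).[y k].

(** A spline in the truncated power basis. Order 0 is absent because continuity leaves no jump of
    that order; the lower bound [a] allows the origin to be split off. *)
Definition trunc_sum (R : realType) (n a b : nat) (y : nat -> R)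
    (c : nat -> nat -> R) (t : R) : R :=
  \sum_(a <= k < b) \sum_(1 <= j < n.+1) c k j * Num.max (t - y k) 0 ^+ j.

Lemma half_pieces_ge0 (R : realType) (n : nat) (h : R -> R) (y : nat -> R)
    (q : nat -> {poly R}) (k : nat) : half_pieces n h y q -> 0 <= y k.
Proof.
by move=> [<- ylt _ _ _]; rewrite (ltW_homo (f := y))// => i j; exact: ylt.
Qed.

Lemma half_pieces_itv (R : realType) (n : nat) (h : R -> R) (y : nat -> R)
    (q : nat -> {poly R}) (k : nat) :
  half_pieces n h y q -> {in `]y k, y k.+1[, h =1 horner (q k)}.
Proof.
by move=> [_ _ _ hq _] t /andP[kt tk]; apply: hq; rewrite !ltW.
Qed.

Lemma half_pieces_locate (R : realType) (n : nat) (h : R -> R) (y : nat -> R)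
    (q : nat -> {poly R}) (t : R) :
  half_pieces n h y q -> 0 < t -> exists k : nat, y k < t <= y k.+1.
Proof.
move=> [y0 _ yM _ _] t0.
have yt : exists k, t <= y k by have [k /ltW] := yM t; exists k.
case: (ex_minnP yt) => -[|k] kP kmin; first by move: kP; rewrite y0; lra.
by exists k; rewrite kP andbT ltNge; apply/negP => /kmin; rewrite ltnn.
Qed.

(** Taylor expansion at [y k] of the difference of consecutive pieces: its constant term is 0 by
    continuity for positive [k], and [h 0] for [k = 0]. *)
Lemma jump_taylor (R : realType) (n : nat) (h : R -> R) (y : nat -> R)
    (q : nat -> {poly R}) (k : nat) (t : R) : half_pieces n h y q ->
  \sum_(1 <= j < n.+1) jump y q k j * (t - y k) ^+ j =
  (q k).[t] - (if k is k'.+1 then (q k').[t] else h 0).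
Proof.
move=> [y0 ylt _ hq sq].
have ylt1 i : y i < y i.+1 by exact: ylt.
set p := if k is k'.+1 then q k' else 0.
have sp : (size (q k - p)%R <= n.+1)%N.
  rewrite (leq_trans (size_polyD _ _))// geq_max sq size_polyN /p.
  by case: k @p => [|k]; rewrite ?size_poly0 ?sq.
have := nderiv_taylor_wide (mulrC (y k) (t - y k)) sp.
rewrite addrCA subrr addr0 -(big_mkord xpredT
  (fun i => (q k - p)^`N(i).[y k] * (t - y k) ^+ i)).
rewrite big_ltn// nderivn0 expr0 mulr1 /jump -/p => E.
transitivity ((q k - p).[t] - (q k - p).[y k]).
  by rewrite E addrAC subrr add0r.
rewrite !hornerE /p.
case: k {E} @p {sp} => [|k]; last first.
  rewrite -(hq k.+1 (y k.+1)) ?lexx ?ltW// -(hq k (y k.+1)) ?lexx ?ltW//.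
  by rewrite subrr subr0.
by rewrite !horner0 !subr0 -(hq 0%N (y 0%N)) ?lexx ?ltW// y0.
Qed.

Lemma half_expansion (R : realType) (n : nat) (h : R -> R) (y : nat -> R)
    (q : nat -> {poly R}) (K : nat) (t : R) : half_pieces n h y q ->
  0 <= t <= y K -> h t = h 0 + trunc_sum n 0 K y (jump y q) t.
Proof.
move=> hp; have [y0 ylt _ hq _] := hp; elim: K t => [|K IH] t /andP[t0 tK].
  by rewrite /trunc_sum big_geq// addr0; congr h; lra.
(* Up to [y K] the new node contributes nothing; beyond it every truncated power is a genuine power
   and the sum telescopes over the pieces. *)
have [tyK|/ltW yKt] := leP t (y K).
  rewrite IH ?t0// /trunc_sum big_nat_recr//= [X in _ = _ + (_ + X)]big_nat_cond.
  rewrite [X in _ = _ + (_ + X)]big1 ?addr0// => j /andP[/andP[j0 _] _].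
  by rewrite max_r ?subr_le0// expr0n gtn_eqF// mulr0.
rewrite (hq K) ?yKt// addrC; apply/esym.
transitivity (\sum_(0 <= k < K.+1)
    ((q k).[t] - (if k is k'.+1 then (q k').[t] else h 0)) + h 0); last first.
  rewrite big_nat_recl//= (telescope_sumr (fun k => (q k).[t]))//; ring.
congr (_ + _); apply: eq_big_nat => k /andP[_ kK].
rewrite -(jump_taylor k t hp); apply: eq_bigr => j _.
by rewrite max_l// subr_ge0 (le_trans _ yKt)// (ltW_homo (f := y)).
Qed.

(** * Monotonicity and scaling of truncated power sums *)

Lemma trunc_power_le (R : realType) (s t : R) (j : nat) :
  s <= t -> Num.max s 0 ^+ j <= Num.max t 0 ^+ j.
Proof.
move=> st; apply: lerXn2r; rewrite ?nnegrE; [by rewrite le_max lexx orbT..|].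
by rewrite ge_max !le_max st lexx !orbT.
Qed.

Lemma trunc_sum_dist (R : realType) (n a b : nat) (y : nat -> R)
    (c : nat -> nat -> R) (s t : R) : s <= t ->
  `|trunc_sum n a b y c t - trunc_sum n a b y c s| <=
  trunc_sum n a b y (fun k j => `|c k j|) t -
  trunc_sum n a b y (fun k j => `|c k j|) s.
Proof.
move=> st; rewrite /trunc_sum -!sumrB (le_trans (ler_norm_sum _ _ _))//.
apply: ler_sum => k _; rewrite -!sumrB (le_trans (ler_norm_sum _ _ _))//.
apply: ler_sum => j _; rewrite -!mulrBr normrM ler_wpM2l//.
by rewrite ger0_norm// subr_ge0 trunc_power_le// lerB.
Qed.

(** For [t > y], [l * t - y >= l * (t - y)] as [y >= 0], and [l ^+ j >= l]. Summed up, this makes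
    the majorant unbounded as soon as it has a positive value. *)
Lemma trunc_power_scale (R : realType) (y t l : R) (j : nat) : (0 < j)%N ->
  1 <= l -> 0 <= y ->
  l * Num.max (t - y) 0 ^+ j <= Num.max (l * t - y) 0 ^+ j.
Proof.
move=> j0 l1 y0; have [ty|yt] := leP (t - y) 0.
  by rewrite expr0n gtn_eqF// mulr0 exprn_ge0// le_max lexx orbT.
apply: (@le_trans _ _ ((l * (t - y)) ^+ j)).
  rewrite exprMn; apply: ler_wpM2r; first by rewrite exprn_ge0// ltW.
  by rewrite -{1}[l]expr1 ler_weXn2l.
apply: lerXn2r; rewrite ?nnegrE.
- by rewrite mulr_ge0//; lra.
- by rewrite le_max lexx orbT.
- by rewrite le_max mulrBr lerD2l lerN2 ler_peMl.
Qed.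

Lemma trunc_sum_scale (R : realType) (n a b : nat) (y : nat -> R)
    (c : nat -> nat -> R) (l t : R) :
  (forall k, 0 <= y k) -> (forall k j, 0 <= c k j) -> 1 <= l ->
  l * trunc_sum n a b y c t <= trunc_sum n a b y c (l * t).
Proof.
move=> y0 c0 l1; rewrite /trunc_sum mulr_sumr; apply: ler_sum => k _.
rewrite mulr_sumr big_nat_cond [leRHS]big_nat_cond.
apply: ler_sum => j /andP[/andP[j0 _] _].
by rewrite mulrCA ler_wpM2l// trunc_power_scale.
Qed.

Lemma trunc_sum_ge0 (R : realType) (n a b : nat) (y : nat -> R)
    (c : nat -> nat -> R) (t : R) :
  (forall k j, 0 <= c k j) -> 0 <= trunc_sum n a b y c t.
Proof.
move=> c0; apply: sumr_ge0 => k _; apply: sumr_ge0 => j _.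
by rewrite mulr_ge0// exprn_ge0// le_max lexx orbT.
Qed.

(** * Jumps at the nodes and the counting functions *)

Definition two_sided_pieces (R : realType) (n : nat) (f : R -> R)
    (y y' : nat -> R) (q q' : nat -> {poly R}) : Prop :=
  half_pieces n f y q /\ half_pieces n (f \o -%R) y' q'.

Lemma omega_jump0 (R : realType) (n : nat) (f : R -> R)
    (y y' : nat -> R) (q q' : nat -> {poly R}) (j : nat) :
  two_sided_pieces n f y y' q q' ->
  omega f j 0 = jump y q 0 j + jump y' q' 0 j.
Proof.
move=> [hp hp']; have [y0 ylt _ _ _] := hp; have [y'0 y'lt _ _ _] := hp'.
have := half_pieces_itv (k := 0) hp; have := half_pieces_itv (k := 0) hp'.
rewrite y0 y'0 => fq' fq; rewrite (omega_zero j _ _ fq fq').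
- by rewrite /jump y0 y'0 !subr0 !horner_coef0 !coef_nderivn !addn0 !binn.
- by rewrite -y0 ylt.
- by rewrite -y'0 y'lt.
Qed.

Lemma omega_jump (R : realType) (n : nat) (f : R -> R)
    (y : nat -> R) (q : nat -> {poly R}) (k j : nat) :
  half_pieces n f y q -> (0 < k)%N -> omega f j (y k) = jump y q k j.
Proof.
move=> hp; case: k => [//|k] _; have [_ ylt _ _ _] := hp.
apply: (omega_pos _ (half_pieces_ge0 k hp) _ (half_pieces_itv (k := k) hp)
  (half_pieces_itv (k := k.+1) hp)).
by rewrite !ylt.
Qed.

Lemma omega_jumpN (R : realType) (n : nat) (f : R -> R)
    (y : nat -> R) (q : nat -> {poly R}) (k j : nat) :
  half_pieces n (f \o -%R) y q -> (0 < k)%N ->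
  omega f j (- y k) = jump y q k j.
Proof.
move=> hp; case: k => [//|k] _; have [_ ylt _ _ _] := hp.
apply: (omega_neg _ (half_pieces_ge0 k hp) _ (half_pieces_itv (k := k) hp)
  (half_pieces_itv (k := k.+1) hp)).
by rewrite !ylt.
Qed.

(** Away from the nodes both sides carry the same polynomial; [K] only cuts the nodes to a finite
    list reaching beyond the modulus of [z]. *)
Lemma omega_eq0 (R : realType) (n : nat) (f : R -> R)
    (y y' : nat -> R) (q q' : nat -> {poly R}) (K j : nat) (z : R) :
  two_sided_pieces n f y y' q q' -> z != 0 ->
  `|z| < y K -> `|z| < y' K ->
  z \notin [seq y k | k <- index_iota 1 K] ->
  z \notin [seq - y' k | k <- index_iota 1 K] ->
  omega f j z = 0.
Proof.
have notin (h : R -> R) (x : nat -> R) (r : nat -> {poly R}) (t : R) :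
    half_pieces n h x r -> 0 < t -> t < x K ->
    t \notin [seq x k | k <- index_iota 1 K] ->
    exists k, x k < t < x k.+1.
  move=> hp t0 tK tn; have [_ xlt _ _ _] := hp.
  have [k /andP[kt]] := half_pieces_locate hp t0.
  rewrite le_eqVlt => /predU1P[tk|tk]; last by exists k; rewrite kt.
  move/negP: tn; case; rewrite tk; apply/mapP; exists k.+1 => //.
  rewrite mem_index_iota /= ltnNge; apply/negP => Kk.
  suff : x K <= x k.+1 by rewrite -tk leNgt tK.
  exact: (ltW_homo (f := x)).
move=> [hp hp'] z0 zy zy' zn zn'; have [z_gt0|z_le0] := ltP 0 z.
  move: zy zy' zn; rewrite gtr0_norm// => zy zy' zn.
  have [k /andP[kz zk]] := notin _ _ _ _ hp z_gt0 zy zn.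
  have fq := half_pieces_itv (k := k) hp.
  rewrite (@omega_pos _ _ (q k) (q k) (y k) _ (y k.+1)) ?kz ?zk//.
  - by rewrite subrr linear0 horner0.
  - exact: half_pieces_ge0 _ hp.
  - by move=> t; rewrite in_itv/= => tI; apply: fq; rewrite in_itv/=; lra.
  - by move=> t; rewrite in_itv/= => tI; apply: fq; rewrite in_itv/=; lra.
have z_lt0 : z < 0 by rewrite lt_neqAle z0.
move: zy zy' zn'; rewrite ltr0_norm// => zy zy' zn'.
have zn2 : - z \notin [seq y' k | k <- index_iota 1 K].
  apply: contra zn' => /mapP[k kK zk]; apply/mapP.
  by exists k; rewrite // -zk opprK.
have zN : 0 < - z by rewrite oppr_gt0.
have [k /andP[kz zk]] := notin _ _ _ _ hp' zN zy' zn2.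
have fq := half_pieces_itv (k := k) hp'; rewrite -[z]opprK.
rewrite (@omega_neg _ _ (q' k) (q' k) (y' k) _ (y' k.+1)) ?kz ?zk//.
- by rewrite subrr linear0 horner0.
- exact: half_pieces_ge0 _ hp'.
- by move=> t; rewrite in_itv/= => tI; apply: fq; rewrite in_itv/=; lra.
- by move=> t; rewrite in_itv/= => tI; apply: fq; rewrite in_itv/=; lra.
Qed.

(** The first maximum vanishes off the poles and the second outside ]-t, t[, so the sum over poles
    may be extended to all reals and then restricted to the nodes. *)
Lemma counting_fun_jumps (R : realType) (n : nat) (f : R -> R)
    (y y' : nat -> R) (q q' : nat -> {poly R}) (K j : nat) (t : R) :
  two_sided_pieces n f y y' q q' -> (0 < j)%N ->
  0 <= t <= y K -> t <= y' K ->
  2 * counting_fun f j t =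
  Num.max (- omega f j 0) 0 * t ^+ j +
  \sum_(1 <= k < K) Num.max (- jump y q k j) 0 * Num.max (t - y k) 0 ^+ j +
  \sum_(1 <= k < K) Num.max (- jump y' q' k j) 0 * Num.max (t - y' k) 0 ^+ j.
Proof.
move=> tp j0 /andP[t0 ty] ty'; have [hp hp'] := tp.
have [_ ylt _ _ _] := hp; have [_ y'lt _ _ _] := hp'.
have y_gt0 k : (0 < k)%N -> 0 < y k.
  by move=> k0; rewrite -(_ : y 0%N = 0) ?ylt//; case: hp.
have y'_gt0 k : (0 < k)%N -> 0 < y' k.
  by move=> k0; rewrite -(_ : y' 0%N = 0) ?y'lt//; case: hp'.
set s1 := [seq y k | k <- index_iota 1 K].
set s2 := [seq - y' k | k <- index_iota 1 K].
have s1P z : z \in s1 -> 0 < z.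
  by move=> /mapP[k]; rewrite mem_index_iota => /andP[k0 _] ->; exact: y_gt0.
have s2P z : z \in s2 -> z < 0.
  move=> /mapP[k]; rewrite mem_index_iota => /andP[k0 _] ->.
  by rewrite oppr_lt0 y'_gt0.
(* The three groups are separated by sign, and distinctness turns the sum over a set into one over a
   list. *)
have us : uniq (0 :: s1 ++ s2).
  have s10 : 0 \notin s1 by apply/negP => /s1P; rewrite ltxx.
  have s20 : 0 \notin s2 by apply/negP => /s2P; rewrite ltxx.
  rewrite /= mem_cat negb_or s10 s20 cat_uniq /=; apply/and3P; split.
  - rewrite /s1 map_inj_uniq ?iota_uniq// => i k; exact: (inc_inj (le_mono ylt)).
  - by apply/hasPn => z /s2P z0; apply/negP => /s1P; rewrite ltNge ltW.
  - rewrite /s2 map_inj_uniq ?iota_uniq// => i k /oppr_inj.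
    exact: (inc_inj (le_mono y'lt)).
pose F z := Num.max (- omega f j z) 0 * Num.max (t - `|z|) 0 ^+ j.
have F0 z : t <= `|z| -> F z = 0.
  move=> tz; rewrite /F [X in X ^+ _]max_r ?subr_le0//.
  by rewrite expr0n gtn_eqF// mulr0.
rewrite /counting_fun mulVKf//.
transitivity (\sum_(z \in [set z : R | - t < z < t /\ is_pole f j z]) F z).
  apply: eq_fsbigr => z; rewrite inE/= -ltr_norml => -[zt pz]; rewrite /F.
  rewrite ltr0_norm// max_l ?oppr_ge0 ?ltW// max_l// subr_ge0 ltW//.
transitivity (\sum_(z \in [set: R]) F z).
  apply: fsbig_widen => // z [_] /=; rewrite -ltr_norml => /not_andP[/negP|/negP].
    by rewrite -leNgt; exact: F0.
  by rewrite -leNgt => oz; rewrite /F max_r ?oppr_le0// mul0r.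
transitivity (\sum_(z \in [set` (0 :: s1 ++ s2)]) F z).
  symmetry; apply: fsbig_widen => // z [_] /= /negP.
  rewrite inE mem_cat !negb_or => /and3P[z0 z1 z2].
  have [/F0//|zt] := leP t `|z|.
  rewrite /F (omega_eq0 _ tp z0 _ _ z1 z2) ?(lt_le_trans zt)//.
  by rewrite oppr0 maxxx mul0r.
rewrite -fsbig_seq// big_cons big_cat /= !big_map.
rewrite {1}/F normr0 subr0 [X in X ^+ _]max_l// addrA.
congr (_ + _ + _); apply: eq_big_nat => k /andP[k0 kK]; rewrite /F.
  by rewrite (omega_jump _ hp)// gtr0_norm ?y_gt0.
by rewrite (omega_jumpN _ hp')// normrN gtr0_norm ?y'_gt0.
Qed.

(** * The majorant and its comparison with the characteristic *)

Lemma trunc_sum_le (R : realType) (n a b : nat) (y : nat -> R)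
    (c : nat -> nat -> R) (s t : R) :
  (forall k j, 0 <= c k j) -> s <= t ->
  trunc_sum n a b y c s <= trunc_sum n a b y c t.
Proof.
move=> c0 st; apply: ler_sum => k _; apply: ler_sum => j _.
by rewrite ler_wpM2l// trunc_power_le// lerB.
Qed.

Lemma trunc_sum_ltn (R : realType) (n K : nat) (y : nat -> R)
    (c : nat -> nat -> R) (t : R) : (0 < K)%N -> y 0%N = 0 -> 0 <= t ->
  trunc_sum n 0 K y c t =
  \sum_(1 <= j < n.+1) c 0%N j * t ^+ j + trunc_sum n 1 K y c t.
Proof.
move=> K0 y0 t0; rewrite /trunc_sum big_ltn// y0 subr0 max_l//.
Qed.

Lemma normr_negpart (R : realType) (x : R) : `|x| = x + 2 * Num.max (- x) 0.
Proof.
by have [x0|x0] := leP (- x) 0; [rewrite ger0_norm|rewrite ltr0_norm]; lra.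
Qed.

(** For jumps, the signed sum is an increment of the function and the negative parts are what the
    counting functions measure. *)
Lemma trunc_sum_norm (R : realType) (n a b : nat) (y : nat -> R)
    (c : nat -> nat -> R) (t : R) :
  trunc_sum n a b y (fun k j => `|c k j|) t =
  trunc_sum n a b y c t +
  2 * trunc_sum n a b y (fun k j => Num.max (- c k j) 0) t.
Proof.
rewrite /trunc_sum mulr_sumr -big_split; apply: eq_bigr => k _ /=.
rewrite mulr_sumr -big_split; apply: eq_bigr => j _ /=.
by rewrite normr_negpart mulrDl mulrA.
Qed.

Lemma sum_counting_fun (R : realType) (n : nat) (f : R -> R)
    (y y' : nat -> R) (q q' : nat -> {poly R}) (K : nat) (t : R) :
  two_sided_pieces n f y y' q q' -> 0 <= t <= y K -> t <= y' K ->
  2 * \sum_(1 <= j < n.+1) counting_fun f j t =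
  \sum_(1 <= j < n.+1) Num.max (- omega f j 0) 0 * t ^+ j +
  trunc_sum n 1 K y (fun k j => Num.max (- jump y q k j) 0) t +
  trunc_sum n 1 K y' (fun k j => Num.max (- jump y' q' k j) 0) t.
Proof.
move=> tp ty ty'; rewrite /trunc_sum.
rewrite [X in _ = _ + X + _]exchange_big [X in _ = _ + X]exchange_big -!big_split.
rewrite mulr_sumr; apply: eq_big_nat => j /andP[j0 _].
exact: (counting_fun_jumps tp j0 ty ty').
Qed.

Lemma trunc_sum_abs (R : realType) (n a b : nat) (y : nat -> R)
    (c : nat -> nat -> R) (t : R) :
  `|trunc_sum n a b y c t| <= trunc_sum n a b y (fun k j => `|c k j|) t.
Proof.
apply: le_trans (ler_norm_sum _ _ _) _; apply: ler_sum => k _.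
apply: le_trans (ler_norm_sum _ _ _) _; apply: ler_sum => j _.
by rewrite normrM [X in _ * X]ger0_norm// exprn_ge0// le_max lexx orbT.
Qed.

(** Terms of one sign do not cancel. Well-definedness acts here: it controls the Taylor coefficients
    of each side at the origin, which the counting functions see only through their sum. *)
Lemma one_signed_sum (R : realType) (n : nat) (a : nat -> R) (t : R) :
  (forall j, (0 < j)%N -> 0 <= a j) \/ (forall j, (0 < j)%N -> a j <= 0) ->
  0 <= t ->
  \sum_(1 <= j < n.+1) `|a j| * t ^+ j = `|\sum_(1 <= j < n.+1) a j * t ^+ j|.
Proof.
move=> sgn t0; case: sgn => sgn.
  rewrite ger0_norm; last first.
    rewrite big_nat_cond; apply: sumr_ge0 => j /andP[/andP[j0 _] _].
    by rewrite mulr_ge0 ?sgn// exprn_ge0.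
  by apply: eq_big_nat => j /andP[j0 _]; rewrite ger0_norm// sgn.
rewrite ler0_norm; last first.
  rewrite big_nat_cond; apply: sumr_le0 => j /andP[/andP[j0 _] _].
  by rewrite mulr_le0_ge0 ?sgn// exprn_ge0.
rewrite -sumrN; apply: eq_big_nat => j /andP[j0 _].
by rewrite ler0_norm ?sgn// mulNr.
Qed.

(* [S] is the sum of the truncated powers with absolute values of the jumps as
   coefficients; the proof starts from its expression through the counting
   functions, which does not mention the number [K] of breakpoints. *)
Lemma tropical_majorant (R : realType) (n : nat) (f : R -> R)
    (y y' : nat -> R) (q q' : nat -> {poly R}) :
  two_sided_pieces n f y y' q q' -> one_signed (q 0%N) -> one_signed (q' 0%N) ->
  (exists t, f t != f 0) ->
  exists (S : R -> R) (C : R),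
    [/\ forall s t, 0 <= s -> s <= t ->
          `|f t - f s| <= S t - S s /\ `|f (- t) - f (- s)| <= S t - S s,
        forall l t, 1 <= l -> 0 <= t -> l * S t <= S (l * t),
        exists2 t, 0 < t & 0 < S t,
        0 < C
      & forall t, 0 <= t -> S t <= C * (characteristic n f t + 1)].
Proof.
move=> tp sq sq' [t0 ft0]; have [hp hp'] := tp.
have [y0 ylt yM _ _] := hp; have [y'0 y'lt y'M _ _] := hp'.
pose c k j := jump y q k j; pose c' k j := jump y' q' k j.
pose B t := \sum_(1 <= j < n.+1) `|c 0%N j| * t ^+ j.
pose B' t := \sum_(1 <= j < n.+1) `|c' 0%N j| * t ^+ j.
pose N t := \sum_(1 <= j < n.+1) counting_fun f j t.
pose S t := 4 * N t + f t + f (- t) - 2 * f 0 + B t + B' t.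
(* The origin's own term: its negative part supplies the share of [4 * N t] due to poles at 0. *)
pose D t := trunc_sum n 0 1 (fun=> 0) (fun _ j => `|omega f j 0|) t.
pose V K t := trunc_sum n 0 K y (fun k j => `|c k j|) t.
pose V' K t := trunc_sum n 0 K y' (fun k j => `|c' k j|) t.
have y_ge0 k := half_pieces_ge0 k hp; have y'_ge0 k := half_pieces_ge0 k hp'.
have nK t : exists2 K, (0 < K)%N & t <= y K /\ t <= y' K.
  have [k yk] := yM t; have [k' yk'] := y'M t.
  exists (k + k').+1 => //; split;
    [apply: le_trans (ltW yk) _|apply: le_trans (ltW yk') _].
    by rewrite (ltW_homo (f := y))// leEnat; lia.
  by rewrite (ltW_homo (f := y'))// leEnat; lia.
have DE t : 0 <= t -> D t =
    \sum_(1 <= j < n.+1) c 0%N j * t ^+ j +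
    \sum_(1 <= j < n.+1) c' 0%N j * t ^+ j +
    2 * \sum_(1 <= j < n.+1) Num.max (- omega f j 0) 0 * t ^+ j.
  move=> t_ge0; rewrite /D /trunc_sum big_nat1 subr0 max_l//.
  rewrite mulr_sumr -!big_split; apply: eq_bigr => j _ /=.
  by rewrite normr_negpart {1}(omega_jump0 j tp) /c /c'; ring.
have fE K t : 0 <= t -> t <= y K -> f t = f 0 + trunc_sum n 0 K y c t.
  by move=> t_ge0 ty; apply: (half_expansion hp); rewrite t_ge0.
have fE' K t : 0 <= t -> t <= y' K -> f (- t) = f 0 + trunc_sum n 0 K y' c' t.
  move=> t_ge0 ty; have := @half_expansion _ _ _ _ _ K t hp'.
  by rewrite /= oppr0 => -> //; rewrite t_ge0.
(* Signed parts over all nodes give the increments of [f] on both half lines, negative parts give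
   [4 * N t]. *)
have SBE K t : (0 < K)%N -> 0 <= t -> t <= y K -> t <= y' K ->
    S t - B t - B' t = trunc_sum n 1 K y (fun k j => `|c k j|) t +
      trunc_sum n 1 K y' (fun k j => `|c' k j|) t + D t.
  move=> K0 t_ge0 ty ty'; rewrite !trunc_sum_norm DE// /S.
  rewrite (fE K)// (fE' K)// !trunc_sum_ltn//.
  have tK : 0 <= t <= y K by rewrite t_ge0.
  have := sum_counting_fun tp tK ty'.
  rewrite -/(N t); lra.
have nn (d : nat -> nat -> R) : forall k j, 0 <= `|d k j| by [].
have SE K t : (0 < K)%N -> 0 <= t -> t <= y K -> t <= y' K ->
    S t = V K t + V' K t + D t.
  move=> K0 t_ge0 ty ty'; have := SBE K t K0 t_ge0 ty ty'.
  rewrite /V /V' !trunc_sum_ltn// -/(B t) -/(B' t); lra.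
have SB_ge0 t : 0 <= t -> 0 <= S t - B t - B' t.
  move=> t_ge0; have [K K0 [ty ty']] := nK t.
  by rewrite (SBE K)// !addr_ge0// trunc_sum_ge0.
have B_ge0 t : 0 <= t -> 0 <= B t.
  by move=> t_ge0; apply: sumr_ge0 => j _; rewrite mulr_ge0 ?exprn_ge0.
have B'_ge0 t : 0 <= t -> 0 <= B' t.
  by move=> t_ge0; apply: sumr_ge0 => j _; rewrite mulr_ge0 ?exprn_ge0.
have Smaj s t : 0 <= s -> s <= t ->
    `|f t - f s| <= S t - S s /\ `|f (- t) - f (- s)| <= S t - S s.
  move=> s0 st; have [K K0 [ty ty']] := nK t; have t_ge0 := le_trans s0 st.
  have [sy sy'] := (le_trans st ty, le_trans st ty').
  rewrite (fE K)// (fE K s)// (fE' K)// (fE' K s)// (SE K)// (SE K s)//.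
  have := trunc_sum_dist n 0 K y c st; have := trunc_sum_dist n 0 K y' c' st.
  have := trunc_sum_le n 0 K y (nn c) st; have := trunc_sum_le n 0 K y' (nn c') st.
  have := trunc_sum_le n 0 1 (fun=> 0) (nn (fun _ j => omega f j 0)) st.
  rewrite -/(V K t) -/(V K s) -/(V' K t) -/(V' K s) -/(D s) -/(D t) => *.
  by split; rewrite opprD addrACA subrr add0r; lra.
(* The estimates at the end give S <= 32 T + 12 |f(0)|, so this constant leaves some room. *)
exists S, (36 + 12 * `|f 0|); split => //.
- move=> l t l1 t_ge0; have l0 : 0 <= l by lra.
  have [K K0 [ty ty']] := nK (l * t).
  have tlt : t <= l * t by rewrite ler_peMl.
  rewrite (SE K (l * t))// ?mulr_ge0// (SE K t)//; try exact: le_trans tlt _.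
  by rewrite !mulrDr !lerD// trunc_sum_scale.
(* [S 0] is nonnegative, and the increment of [S] up to this point is at least |f(t0) - f(0)|, which
   is positive. *)
- exists `|t0|.
    by rewrite normr_gt0; apply: contra ft0 => /eqP ->.
  have [f1 f2] := Smaj 0 `|t0| (lexx _) (normr_ge0 _).
  have := SB_ge0 0 (lexx _); have := B_ge0 0 (lexx _); have := B'_ge0 0 (lexx _).
  have : 0 < `|f t0 - f 0| by rewrite normr_gt0 subr_eq0.
  move: f1 f2; rewrite oppr0; have [t00|t00] := leP 0 t0.
    by rewrite (ger0_norm t00); lra.
  by rewrite (ltr0_norm t00) opprK; lra.
- move=> t t_ge0; have [K K0 [ty ty']] := nK t.
  have := SBE K t K0 t_ge0 ty ty'; have := SB_ge0 t t_ge0.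
  have := B_ge0 t t_ge0; have := B'_ge0 t t_ge0.
  have D0 : 0 <= D t by exact: trunc_sum_ge0.
  have := fE K t t_ge0 ty; have := fE' K t t_ge0 ty'.
  have q0E (x : nat -> R) (r : nat -> {poly R}) j : x 0%N = 0 ->
      jump x r 0 j = (r 0%N)`_j.
    by move=> x0; rewrite /jump x0 subr0 horner_coef0 coef_nderivn addn0 binn.
  have BE : B t = `|\sum_(1 <= j < n.+1) c 0%N j * t ^+ j|.
    by apply: one_signed_sum => //; case: sq => sgn; [left|right] => j j0;
      rewrite /c q0E// sgn.
  have BE' : B' t = `|\sum_(1 <= j < n.+1) c' 0%N j * t ^+ j|.
    by apply: one_signed_sum => //; case: sq' => sgn; [left|right] => j j0;
      rewrite /c' q0E// sgn.
  have NE : 2 * N t =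
      \sum_(1 <= j < n.+1) Num.max (- omega f j 0) 0 * t ^+ j +
      trunc_sum n 1 K y (fun k j => Num.max (- c k j) 0) t +
      trunc_sum n 1 K y' (fun k j => Num.max (- c' k j) 0) t.
    by apply: sum_counting_fun tp _ ty'; rewrite t_ge0.
  move: NE.
  have : 0 <= \sum_(1 <= j < n.+1) Num.max (- omega f j 0) 0 * t ^+ j.
    by apply: sumr_ge0 => j _; rewrite mulr_ge0 ?exprn_ge0// le_max lexx orbT.
  have neg_ge0 (d : nat -> nat -> R) : forall k j, 0 <= Num.max (- d k j) 0.
    by move=> k j; rewrite le_max lexx orbT.
  have := trunc_sum_ge0 n 1 K y t (neg_ge0 c).
  have := trunc_sum_ge0 n 1 K y' t (neg_ge0 c').
  rewrite !trunc_sum_ltn//.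
  have := trunc_sum_abs n 1 K y c t; have := trunc_sum_abs n 1 K y' c' t.
  rewrite !ler_norml.
  set A := \sum_(1 <= j < n.+1) c 0%N j * _ in BE *.
  set A' := \sum_(1 <= j < n.+1) c' 0%N j * _ in BE' *.
  rewrite BE BE' /S -/(N t) BE BE'.
  set T := characteristic n f t.
  have TE : T = 2^-1 * (Num.max (f t) 0 + Num.max (f (- t)) 0) + N t by [].
  have maxl (u : R) : u <= Num.max u 0 /\ 0 <= Num.max u 0.
    by rewrite !le_max !lexx orbT.
  have [u1 u2] := maxl (f t); have [v1 v2] := maxl (f (- t)).
  have /andP[g1 g2] : - `|f 0| <= f 0 <= `|f 0| by rewrite -ler_norml.
  clear BE BE'.
  move: (f t) (f (- t)) (N t) (Num.max (f t) 0) (Num.max (f (- t)) 0) T A A'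
    (trunc_sum n 1 K y c t) (trunc_sum n 1 K y' c' t) (D t) D0 TE u1 u2 v1 v2.
  move=> u v Nt u' v' T A A' X X' Dt D0 TE u1 u2 v1 v2.
  move=> /andP[X1 X2] /andP[X3 X4] n1 n2 n3 NE vE uE b b' W0 WE.
  have TT : 0 <= `|f 0| * T by rewrite mulr_ge0//; lra.
  (* [A] is f(t) - f(0) minus the sum [X] over the later nodes. The nonnegative quantity S - B - B'
     bounds f(t) from below, and being itself at most 4 T + 2 |f(0)| it bounds |X|. *)
  have BA : `|A| <= 14 * T + 5 * `|f 0| by rewrite ler_norml; lra.
  have BA' : `|A'| <= 14 * T + 5 * `|f 0| by rewrite ler_norml; lra.
  lra.
Qed.

(** * Growth outside an exceptional set *)

Lemma powR_nincr (R : realType) (a b d : R) : 0 < a -> a <= b -> 0 <= d ->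
  b `^ (- d) <= a `^ (- d).
Proof.
move=> a0 ab d0; have b0 : 0 < b by lra.
rewrite !powRN lef_pV2 ?posrE ?powR_gt0// ge0_ler_powR// nnegrE; lra.
Qed.

(** The tangent at [b] of a convex power. Divided by b^(-d), it follows from exp(u) >= 1 + u and
    ln(v) <= v - 1 with v = a / b. *)
Lemma powRN_tangent (R : realType) (a b d : R) : 0 < a -> a <= b -> 0 < d ->
  d * (b - a) * b `^ (- (1 + d)) <= a `^ (- d) - b `^ (- d).
Proof.
move=> a0 ab d0; have b0 : 0 < b by lra.
have ab0 : 0 < a / b by rewrite divr_gt0.
have -> : a `^ (- d) = b `^ (- d) * (a / b) `^ (- d).
  by rewrite -(powRM _ (ltW b0) (ltW ab0)) mulrCA divff ?gt_eqF// mulr1.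
rewrite opprD powRD; last by apply/implyP; rewrite (gt_eqF b0).
rewrite (powR_inv1 (ltW b0)); set B := b `^ (- d).
have B0 : 0 < B by rewrite powR_gt0.
suff : d * ((b - a) / b) <= (a / b) `^ (- d) - 1.
  rewrite -(ler_pM2l B0) mulrBr mulr1.
  by have -> : B * (d * ((b - a) / b)) = d * (b - a) * (b^-1 * B) by ring.
have lnab : ln (a / b) <= a / b - 1.
  have := @le_ln1Dx R (a / b - 1); rewrite [1 + _]addrC subrK; apply; lra.
have := expR_ge1Dx (- d * ln (a / b)); rewrite /powR (gt_eqF ab0).
have : d * ln (a / b) <= d * (a / b - 1) by rewrite ler_pM2l.
rewrite mulrBl divff ?gt_eqF//; lra.
Qed.

(** The exponent d = (1 - s) / rho - 1 solves rho (1 + d) = 1 - s. The bound on [b] then gives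
    b^(-(1+d)) >= A^(-(1+d)) X^(s-1); multiplied by the gain X^(-s) this has size 1 / X, and the
    tangent inequality applies. *)
Lemma log_gain (R : realType) (X A rho s a b : R) : 0 < X -> 0 < A ->
  0 < rho -> rho + s < 1 -> 1 <= a -> a <= b -> b <= A * X `^ rho ->
  X `^ (- s) <= b - a ->
  X^-1 <= A `^ ((1 - s) / rho) / ((1 - s) / rho - 1) *
    (a `^ (- ((1 - s) / rho - 1)) - b `^ (- ((1 - s) / rho - 1))).
Proof.
move=> X0 A0 rho0 rs a1 ab bA Xs.
have : 0 < (1 - s) / rho - 1 by rewrite subr_gt0 ltr_pdivlMr//; lra.
set d := (1 - s) / rho - 1 => d0.
have dE : (1 - s) / rho = 1 + d by rewrite /d addrCA subrr addr0.
have Xr0 : 0 < X `^ rho by rewrite powR_gt0.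
have bpow : A `^ (- (1 + d)) * X `^ (s - 1) <= b `^ (- (1 + d)).
  have -> : X `^ (s - 1) = (X `^ rho) `^ (- (1 + d)).
    by rewrite -powRrM -dE mulrN mulrCA divff ?gt_eqF// mulr1 opprB.
  rewrite -(powRM _ (ltW A0) (ltW Xr0)); apply: powR_nincr => //; lra.
have a0 : 0 < a by lra.
have := powRN_tangent a0 ab d0; rewrite dE => tang.
have gain : d * X `^ (- s) * (A `^ (- (1 + d)) * X `^ (s - 1)) <=
    a `^ (- d) - b `^ (- d).
  apply: le_trans tang; apply: ler_pM => //.
  - by rewrite mulr_ge0 ?powR_ge0// ltW.
  - by rewrite mulr_ge0 ?powR_ge0.
  - by rewrite ler_pM2l.
have A1 : 0 < A `^ (1 + d) by rewrite powR_gt0.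
have XE : X `^ (- s) * X `^ (s - 1) = X^-1.
  rewrite -powRD; last by apply/implyP; rewrite (gt_eqF X0).
  by rewrite addrA addNr add0r powR_inv1// ltW.
have AE : A `^ (1 + d) * A `^ (- (1 + d)) = 1.
  by rewrite powRN divff// gt_eqF.
set Y := A `^ (1 + d) in A1 AE *.
have -> : X^-1 = Y / d * (d * X `^ (- s) * (A `^ (- (1 + d)) * X `^ (s - 1))).
  transitivity (d / d * (Y * A `^ (- (1 + d))) * (X `^ (- s) * X `^ (s - 1))).
    by rewrite AE XE divff ?gt_eqF// !mul1r.
  ring.
by rewrite ler_pM2l// divr_gt0.
Qed.

(** A difference over three steps is a one-step difference of the sums of three consecutive
    values. *)
Lemma sum_telescope3 (R : realType) (u w : nat -> R) (C : R) (K : nat) :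
  0 <= C -> (forall k, 0 <= u k) -> (forall k, w k <= C * (u k - u k.+3)) ->
  \sum_(0 <= k < K) w k <= C * (u 0%N + u 1%N + u 2%N).
Proof.
move=> C0 u0 wu; pose v k := u k + u k.+1 + u k.+2.
apply: (@le_trans _ _ (\sum_(0 <= k < K) C * (v k - v k.+1))).
  by apply: ler_sum => k _; rewrite (le_trans (wu k))// ler_wpM2l// /v; lra.
rewrite -mulr_sumr ler_wpM2l//.
have -> : \sum_(0 <= k < K) (v k - v k.+1) = v 0%N - v K.
  rewrite -opprB -(telescope_sumr v)// -sumrN.
  by apply: eq_bigr => k _; rewrite opprB.
by rewrite lerBlDr -/(v 0%N) lerDl !addr_ge0.
Qed.

(** On each cell 1 / r is at most its value at the left end; the disjoint cells are summed by
    countable additivity. *)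
Lemma finite_log_measure_bigcup (R : realType) (g : nat -> R) (b : pred nat)
    (C : R) : 0 < g 0%N -> {homo g : i j / (i < j)%N >-> i < j} ->
  (forall K, \sum_(0 <= k < K | b k) (g k.+1 - g k) / g k <= C) ->
  finite_log_measure (\bigcup_(k in [set k | b k]) [set` `[g k, g k.+1[]).
Proof.
move=> g0 glt gC; have g_gt0 k : 0 < g k.
  by case: k => [//|k]; exact: lt_trans g0 (glt _ _ _).
pose F k := if b k then [set` `[g k, g k.+1[] else set0.
have -> : \bigcup_(k in [set k | b k]) [set` `[g k, g k.+1[] = \bigcup_k F k.
  apply/seteqP; split => r [k] /=.
    by move=> bk rk; exists k => //; rewrite /F bk.
  by rewrite /F; case: ifPn => // bk _ rk; exists k.
have Fpos k r : F k r -> g k <= r < g k.+1.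
  by rewrite /F; case: ifP => //= _; rewrite in_itv.
have mF k : measurable (F k) by rewrite /F; case: ifP => _; [exact: measurable_itv|].
have mE : measurable (\bigcup_k F k) by exact: bigcup_measurable.
have Epos r : (\bigcup_k F k) r -> 0 < r.
  by move=> [k _ /Fpos/andP[gr _]]; exact: lt_le_trans gr.
have mV (D : set R) : measurable D -> D `<=` \bigcup_k F k ->
    measurable_fun D (EFin \o (fun r : R => r^-1)).
  move=> mD DE; apply/measurable_EFinP.
  apply: (@eq_measurable_fun _ _ _ _ _ (fun r : R => r `^ (-1))).
    by move=> r; rewrite inE => /DE/Epos/ltW r0; rewrite powR_inv1.
  exact: measurable_funTS (measurable_powR (-1)).
split=> // [r /Epos|]; first by rewrite /= in_itv/= andbT.
apply: (@le_lt_trans _ _ C%:E); last by rewrite ltry.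
apply: (@le_trans _ _ (\int[lebesgue_measure]_(r in \bigcup_k F k) (r^-1)%:E)%E).
  apply: ge0_subset_integral => //; first exact: measurableI.
  - exact: mV.
  - by move=> r /Epos r0; rewrite lee_fin invr_ge0 ltW.
rewrite ge0_integral_bigcup//=; last 3 first.
- exact: mV.
- by move=> r /Epos r0; rewrite lee_fin invr_ge0 ltW.
- apply: ltn_trivIset => j i ij; apply/seteqP; split => // r [/Fpos/andP[_ ri]].
  move=> /Fpos/andP[jr _]; suff : g i.+1 <= g j by lra.
  by rewrite (ltW_homo (f := g)).
apply: lime_le.
  apply: is_cvg_ereal_nneg_natsum => k _; apply: integral_ge0 => r rk.
  by rewrite lee_fin invr_ge0 ltW//; apply: Epos; exists k.
apply: nearW => K; apply: (@le_trans _ _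
    (\sum_(0 <= k < K | b k) (g k.+1 - g k) / g k)%:E); last by rewrite lee_fin.
rewrite -sumEFin [leRHS]big_mkcond; apply: lee_sum => k _.
apply: (@le_trans _ _ (\int[lebesgue_measure]_(r in F k) (cst (g k)^-1%:E r))%E).
  apply: ge0_le_integral => //.
  - exact: mF.
  - by move=> r /Fpos/andP[gr _]; rewrite lee_fin invr_ge0 (le_trans _ gr)// ltW.
  - by apply: mV => // r rk; exists k.
  - move=> r /Fpos/andP[gr _]; rewrite lee_fin lef_pV2 ?posrE//.
    exact: lt_le_trans gr.
rewrite /F; case: ifP => bk; last by rewrite integral_set0.
rewrite integral_cst; last exact: measurable_itv.
rewrite /= lebesgue_measure_itv/= lte_fin glt// -EFinB -EFinM lee_fin.
by rewrite mulrC.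
Qed.

(* The exceptional set is a union of grid cells [g k.+1, g k.+2[; by [log_gain]
   the logarithmic measure of a bad cell is at most a multiple of
   [u k - u k.+3], which telescopes. *)
Lemma log_growth_exceptional (R : realType) (L : R -> R) (h A rho s M : R) :
  0 < h -> 0 < A -> 0 < rho -> 0 < s -> rho + s < 1 ->
  (forall x y, M <= x -> x <= y -> L x <= L y) ->
  (forall x, M <= x -> 1 <= L x <= A * x `^ rho) ->
  exists E : set R, finite_log_measure E /\
    exists N : R, forall r, N <= r -> ~ E r -> L (r + h) - L (r - h) <= r `^ (- s).
Proof.
move=> h0 A0 rho0 s0 rs Lnd LA.
(* The grid starts beyond [M], and [0 < a] keeps every grid point at least [h], so that neighbouring
   points are comparable. *)
have [a aM a0] : exists2 a : nat, M <= a%:R * h & (0 < a)%N.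
  exists (Num.bound (`|M| / h)).+1 => //.
  have := archi_boundP (divr_ge0 (normr_ge0 M) (ltW h0)).
  rewrite ltr_pdivrMr// -natr1 mulrDl mul1r => bM.
  by have := ler_norm M; lra.
pose g k : R := (a + k)%:R * h.
have gS k : g k.+1 = g k + h by rewrite /g addnS -natr1 mulrDl mul1r.
have glt : {homo g : i j / (i < j)%N >-> i < j}.
  by move=> i j ij; rewrite ltr_pM2r// ltr_nat ltn_add2l.
have gle i j : (i <= j)%N -> g i <= g j by move=> ij; rewrite (ltW_homo (f := g)).
have g0 : h <= g 0%N.
  by rewrite -[leLHS]mul1r ler_pM2r// ler1n addn0.
have gh k : h <= g k by rewrite (le_trans g0)// gle.
have gM k : M <= g k by rewrite (le_trans aM)// -[a in leLHS]addn0 gle.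
(* For [r] in the cell from [g k.+1] to [g k.+2] the window of radius [h] lies between [g k] and
   [g k.+3]. As [r < g k.+2], a cell that is not bad satisfies the desired bound throughout. *)
pose b k := g k.+2 `^ (- s) < L (g k.+3) - L (g k).
pose d := (1 - s) / rho - 1.
have d0 : 0 < d by rewrite subr_gt0 ltr_pdivlMr//; lra.
pose u k := L (g k) `^ (- d).
(* The factor 3 comes from [g k.+3 = g k.+1 + 2 * h <= 3 * g k.+1], the last factor from
   [log_gain]. *)
pose C := 3 * h * (A `^ ((1 - s) / rho) / d).
have C0 : 0 <= C by rewrite !mulr_ge0 ?powR_ge0 ?invr_ge0 ?ltW.
exists (\bigcup_(k in [set k | b k]) [set` `[g k.+1, g k.+2[]); split.
  apply: (@finite_log_measure_bigcup _ (fun k => g k.+1) b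
    (C * (u 0%N + u 1%N + u 2%N))) => //.
  - by have := gh 1%N; lra.
  - by move=> i j ij; apply: glt.
  move=> K; rewrite big_mkcond; apply: sum_telescope3 => // k.
    exact: powR_ge0.
  have L1 : 1 <= L (g k) by have /andP[] := LA _ (gM k).
  have L3 : L (g k) <= L (g k.+3) by rewrite Lnd// gle// -addn3 leq_addr.
  case: ifPn => [bk|_]; last first.
    by rewrite mulr_ge0// subr_ge0 powR_nincr// ?ltW//; lra.
  have X0 : 0 < g k.+3 by have := gh k.+3; lra.
  have := @log_gain R (g k.+3) A rho s (L (g k)) (L (g k.+3)) X0 A0 rho0 rs L1 L3.
  have /andP[_ ->] := LA _ (gM k.+3); rewrite -/d => /(_ isT) gain.
  have /gain gk : g k.+3 `^ (- s) <= L (g k.+3) - L (g k).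
    apply: le_trans (ltW bk); apply: powR_nincr => //; [|exact: gle|exact: ltW].
    by have := gh k.+2; lra.
  apply: (@le_trans _ _ (3 * h * (g k.+3)^-1)).
    have -> : g k.+2 - g k.+1 = h by rewrite (gS k.+1) addrAC subrr add0r.
    have gk1 : 0 < g k.+1 by have := gh k.+1; lra.
    have -> : 3 * h * (g k.+3)^-1 = h * (3 / g k.+3) by ring.
    rewrite ler_pM2l// -[leLHS]mul1r ler_pdivrMr// mulrAC ler_pdivlMr//.
    by have := gh k.+1; rewrite (gS k.+2) (gS k.+1); lra.
  by rewrite -[leRHS]mulrA ler_wpM2l// mulr_ge0// ltW.
exists (g 1%N) => r gr rE.
have r0 : 0 <= r / h by rewrite divr_ge0// ltW//; have := gh 1%N; lra.
have /andP[tr rt] := truncn_itv r0.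
move: tr rt; rewrite ler_pdivlMr// ltr_pdivrMr// => tr rt.
have at1 : (a.+1 <= Num.truncn (r / h))%N.
  rewrite truncn_ge_nat// ler_pdivlMr//.
  by move: gr; rewrite /g addn1.
pose k := (Num.truncn (r / h) - a.+1)%N.
have ak : (a + k.+1)%N = Num.truncn (r / h) by rewrite addnS -addSn subnKC.
have kr : g k.+1 <= r by rewrite /g ak.
have rk : r < g k.+2 by rewrite /g addnS ak.
have : ~~ b k.
  by apply/negP => bk; apply: rE; exists k => //=; rewrite in_itv/= kr.
rewrite -leNgt => Lk.
have L1 : L (r + h) <= L (g k.+3).
  apply: Lnd; last by rewrite (gS k.+2); lra.
  by have := gM 1%N; lra.
have L2 : L (g k) <= L (r - h).
  by apply: Lnd; [exact: gM | move: kr; rewrite gS; lra].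
apply: (@le_trans _ _ (g k.+2 `^ (- s))); first lra.
by apply: powR_nincr; [have := gh 1%N; lra|exact: ltW|exact: ltW].
Qed.

(** If ln S gains at most x = r^(-s) <= 1 over the window, then S grows at most by the factor
    exp(x), and exp(x) - 1 <= x exp(x) <= e x. *)
Lemma growth_exceptional (R : realType) (S : R -> R) (h A rho s M : R) :
  0 < h -> 0 < A -> 0 < rho -> 0 < s -> rho + s < 1 ->
  (forall x y, M <= x -> x <= y -> S x <= S y) ->
  (forall x, M <= x -> expR 1 <= S x /\ ln (S x) <= A * x `^ rho) ->
  exists E : set R, finite_log_measure E /\
    exists N : R, forall r, N <= r -> ~ E r ->
      S (r + h) - S (r - h) <= expR 1 * r `^ (- s) * S r.
Proof.
move=> h0 A0 rho0 s0 rs Snd SA.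
have S0 x : M <= x -> 0 < S x.
  by move=> /SA[Sx _]; exact: lt_le_trans (expR_gt0 1) Sx.
have [||E [flE [N NL]]] :=
    @log_growth_exceptional R (fun x => ln (S x)) h A rho s M h0 A0 rho0 s0 rs.
- move=> x y Mx xy /=; rewrite ler_ln ?posrE ?S0 ?Snd//.
  exact: le_trans xy.
- move=> x Mx /=; have [Sx ->] := SA x Mx; rewrite andbT.
  by rewrite -[leLHS]expRK ler_ln ?posrE ?expR_gt0 ?S0.
exists E; split => //; exists (Num.max N (Num.max 1 (M + h))) => r.
rewrite !ge_max => /and3P[Nr r1 Mr] rE; have /= := NL r Nr rE.
set x := r `^ (- s) => Lx.
have x0 : 0 <= x by exact: powR_ge0.
have x1 : x <= 1.
  by have := @powR_nincr R 1 r s ltr01 r1 (ltW s0); rewrite powR1.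
have Sm0 : 0 < S (r - h) by apply: S0; lra.
have Sp0 : 0 < S (r + h) by apply: S0; lra.
have Sle : S (r + h) <= S (r - h) * expR x.
  rewrite -[leLHS]lnK ?posrE// -[X in X * _]lnK ?posrE// -expRD ler_expR; lra.
have ex : expR x - 1 <= x * expR x.
  have := expR_ge1Dx (- x); rewrite expRN => e1.
  have : (1 - x) * expR x <= (expR x)^-1 * expR x by rewrite ler_pM2r ?expR_gt0.
  by rewrite mulVf ?gt_eqF ?expR_gt0//; lra.
have e1 : expR x <= expR 1 by rewrite ler_expR.
apply: (@le_trans _ _ (S (r - h) * (expR x - 1))); first by rewrite mulrBr; lra.
apply: (@le_trans _ _ (S (r - h) * (x * expR 1))).
  by rewrite ler_pM2l// (le_trans ex)// ler_wpM2l.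
rewrite mulrC [x * _]mulrC ler_wpM2l ?mulr_ge0 ?expR_ge0//.
by apply: Snd; lra.
Qed.

(** * The difference operator *)

(** Excludes the value -oo for the hyper-order, which together with its upper bound makes it a real
    number. *)
Lemma limf_esup_pinfty_ge0 (R : realType) (g : R -> R) (M : R) :
  (forall r, M < r -> 0 <= g r) ->
  (0 <= limf_esup (fun r => (g r)%:E) (pinfty_nbhs R))%E.
Proof.
move=> g0; rewrite limf_esupE; apply: le_ereal_inf_tmp => _ [A [N [_ AN]] <-].
have AE : A (Num.max M N + 1) by apply: AN; rewrite ltr_pwDr// le_max lexx orbT.
apply: (@le_trans _ _ (g (Num.max M N + 1))%:E).
  by rewrite lee_fin g0// ltr_pwDr// le_max lexx.
by apply: ereal_sup_ubound; exists (Num.max M N + 1).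
Qed.

Lemma limf_esup_pinfty_lt (R : realType) (g : R -> R) (a : R) :
  (limf_esup (fun r => (g r)%:E) (pinfty_nbhs R) < a%:E)%E ->
  exists M : R, forall r, M < r -> g r < a.
Proof.
rewrite limf_esupE => /ereal_inf_lt[_ [A [M [_ AM]] <-] Aa].
exists M => r Mr; rewrite -lte_fin; apply: le_lt_trans Aa.
by apply: ereal_sup_ubound; exists r => //; exact: AM.
Qed.

(** As |c| <= r, the points r and r + c lie on one half line, and so do -r and -r + c; hence [S]
    dominates both increments. *)
Lemma proximity_shift_le (R : realType) (f S : R -> R) (c r : R) :
  (forall s t, 0 <= s -> s <= t ->
    `|f t - f s| <= S t - S s /\ `|f (- t) - f (- s)| <= S t - S s) ->
  `|c| <= r ->
  `|proximity (fun x => f (x + c) - f x) r| <= S (r + `|c|) - S (r - `|c|).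
Proof.
move=> Smaj cr; have c0 := normr_ge0 c.
have rm0 : 0 <= r - `|c| by lra.
have rr : r - `|c| <= r by lra.
have rp : r <= r + `|c| by lra.
have r0 : 0 <= r by lra.
have [a1 a2] := Smaj _ _ rm0 rr; have [b1 b2] := Smaj _ _ r0 rp.
have maxE (u v : R) : u <= v -> 0 <= v -> 0 <= Num.max u 0 <= v.
  by move=> uv v0; rewrite le_max lexx orbT ge_max uv.
have D0 : 0 <= S (r + `|c|) - S (r - `|c|).
  have := normr_ge0 (f r - f (r - `|c|)).
  by have := normr_ge0 (f (r + `|c|) - f r); lra.
have P1 : f (r + c) - f r <= S (r + `|c|) - S (r - `|c|).
  have := normr_ge0 (f r - f (r - `|c|)); have := normr_ge0 (f (r + `|c|) - f r).
  move: a1 b1; rewrite !ler_norml; have [cp|cn] := leP 0 c.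
    by rewrite (ger0_norm cp); lra.
  by rewrite (ltr0_norm cn) opprK; lra.
have P2 : f (- r + c) - f (- r) <= S (r + `|c|) - S (r - `|c|).
  have := normr_ge0 (f r - f (r - `|c|)); have := normr_ge0 (f (r + `|c|) - f r).
  move: a1 b1 a2 b2; rewrite !ler_norml; have [cp|cn] := leP 0 c.
    by rewrite (ger0_norm cp) (_ : - (r - c) = - r + c); [lra|ring].
  by rewrite (ltr0_norm cn) (_ : - (r + - c) = - r + c); [lra|ring].
rewrite /proximity; have := maxE _ _ P1 D0; have := maxE _ _ P2 D0.
move: (Num.max _ _) (Num.max _ _) => u v uS vS.
by rewrite ger0_norm; lra.
Qed.

Lemma tropical_pieces (R : realType) (n : nat) (f : R -> R) : (0 < n)%N ->
  well_defined_tropical n f ->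
  exists (y y' : nat -> R) (q q' : nat -> {poly R}),
    [/\ two_sided_pieces n f y y' q q', one_signed (q 0%N), one_signed (q' 0%N)
      & exists t, f t != f 0].
Proof.
move=> n0 [x [p [xp wd]]].
have [y [q [hp sq]]] := segmentation_half xp wd.
have [|y' [q' [hp' sq']]] := segmentation_half (segmentation_opp xp).
  by move=> i; exact: well_defined_polyN.
by exists y, y', q, q'; split => //; exact: segmentation_nonconstant n0 xp.
Qed.

Theorem corollary4p8 (R : realType) (n : nat) (hn : (0 < n)%N)
    (c : R) (hc : c != 0) (f : R -> R)
    (hf : tropical_meromorphic n f) (hwd : well_defined_tropical n f)
    (hrho : (hyper_order n f < 1)%E)
    (sigma : R) (hsigma0 : 0 < sigma)
    (hsigma1 : (sigma%:E < 1 - hyper_order n f)%E) :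
  exists E : set R, finite_log_measure E /\
    proximity (fun x => f (x + c) - f x)
      =o_ (within (~` E) (pinfty_nbhs R))
        (fun r => characteristic n f r / r `^ sigma).
Proof.
have [y [y' [q [q' [tp sq sq' fc]]]]] := tropical_pieces hn hwd.
have [S [C [Smaj Sscale [t1 t10 St1] C0 SC]]] := tropical_majorant tp sq sq' fc.
set T := characteristic n f in SC *.
have Snd s t : 0 <= s -> s <= t -> S s <= S t.
  move=> s0 st; have [+ _] := Smaj s t s0 st.
  by have := normr_ge0 (f t - f s); lra.
have Sinfty K : exists2 M, 0 < M & forall r, M <= r -> K <= S r.
  (* Chosen so that [l * S t1] is [S t1] plus the absolute value of [K]. *)
  pose l := 1 + `|K| / S t1; have l1 : 1 <= l by rewrite lerDl divr_ge0// ltW.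
  exists (l * t1) => [|r lr]; first by rewrite mulr_gt0//; lra.
  apply: (@le_trans _ _ (l * S t1)).
    rewrite mulrDl mul1r divfK ?gt_eqF//; have := ler_norm K; lra.
  apply: le_trans (Sscale l t1 l1 (ltW t10)) _.
  by apply: Snd => //; rewrite mulr_ge0//; lra.
(* Compares C (e + 1) <= S(r) <= C (T(r) + 1). With T >= e, both logarithms have arguments at least
   1, clear of the default value of [ln]. *)
have [M M0 TM] : exists2 M, 0 < M & forall r, M <= r -> expR 1 <= T r.
  have [M M0 SM] := Sinfty (C * (expR 1 + 1)); exists M => // r Mr.
  have r0 : 0 <= r by lra.
  by have := le_trans (SM r Mr) (SC r r0); rewrite ler_pM2l// lerD2r.
have e1 : 1 <= expR 1 :> R by have := expR_ge1Dx (1 : R); lra.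
have lnT r : M <= r -> 1 <= ln (T r).
  move=> /TM Tr; rewrite -[leLHS]expRK ler_ln ?posrE ?expR_gt0//.
  exact: lt_le_trans (expR_gt0 1) Tr.
have rho_ge0 : (0 <= hyper_order n f)%E.
  apply: (@limf_esup_pinfty_ge0 _ _ (Num.max M 1)) => r.
  rewrite gt_max => /andP[/ltW Mr r1].
  by rewrite divr_ge0// ln_ge0// ?lnT// ltW.
have [rho rhoE] : exists r0 : R, hyper_order n f = r0%:E.
  by move: hrho rho_ge0; case: hyper_order => // r0 _ _; exists r0.
rewrite rhoE lee_fin in rho_ge0; rewrite rhoE -EFinB lte_fin in hsigma1.
(* Midpoints, giving rho < rho1 < 1 - sigma and sigma < s < 1 - rho1: room for the limsup, for the
   growth lemma and for the little-o. *)
pose rho1 := (rho + (1 - sigma)) / 2; pose s := (sigma + (1 - rho1)) / 2.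
have rho1_gt0 : 0 < rho1 by rewrite /rho1; lra.
have rho1_lt : rho1 < 1 - sigma by rewrite /rho1; lra.
have s_gt : sigma < s by rewrite /s; lra.
have [M1 TM1] : exists M1 : R, forall r, M1 < r -> ln (ln (T r)) / ln r < rho1.
  apply: limf_esup_pinfty_lt.
  by rewrite -/(hyper_order n f) rhoE lte_fin /rho1; lra.
have ST r : M <= r -> S r <= 2 * C * T r.
  move=> Mr; have r0 : 0 <= r by lra.
  apply: le_trans (SC r r0) _; rewrite -mulrA mulrCA ler_pM2l//.
  by have := TM r Mr; lra.
have [M2 M20 SM2] := Sinfty (expR 1).
(* From ln S <= ln(2 C) + ln T with ln T <= r^rho1; as r^rho1 >= 1, the constant is absorbed. *)
pose A := `|ln (2 * C)| + 1.
have A0 : 0 < A by rewrite ltr_wpDl.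
pose M3 := Num.max M (Num.max M2 (Num.max (`|M1| + 1) (expR 1))).
have M3P r : M3 <= r -> [/\ M <= r, M2 <= r, M1 < r & expR 1 <= r].
  rewrite !ge_max => /and4P[-> -> M1r ->]; split=> //.
  by have := ler_norm M1; lra.
have [||||x xM|E [flE [N EN]]] :=
    @growth_exceptional R S `|c| A rho1 s M3 _ A0 rho1_gt0.
- by rewrite normr_gt0.
- by lra.
- by rewrite /s; lra.
- by move=> u v /M3P[Mu _ _ _]; apply: Snd; lra.
- have [Mx M2x M1x ex] := M3P x xM; split; first exact: SM2.
  have lnx : 1 <= ln x by rewrite -[leLHS]expRK ler_ln ?posrE ?expR_gt0//; lra.
  have Tx0 : 0 < T x by have := TM x Mx; lra.
  have lnTx := lnT x Mx.
  have lnTr : ln (T x) <= x `^ rho1.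
    have := TM1 x M1x; rewrite ltr_pdivrMr; last lra.
    rewrite -ln_powR => /ltW; rewrite ler_ln ?posrE//; first lra.
    by rewrite powR_gt0//; lra.
  have xr1 : 1 <= x `^ rho1 by lra.
  have : ln (S x) <= ln (2 * C) + ln (T x).
    have C20 : 0 < 2 * C by lra.
    rewrite -lnM ?posrE// ler_ln ?posrE ?mulr_gt0 ?ST//.
    by have := SM2 x M2x; lra.
  have : `|ln (2 * C)| <= `|ln (2 * C)| * x `^ rho1 by rewrite ler_peMr.
  by rewrite /A; have := ler_norm (ln (2 * C)); lra.
exists E; split => //; apply/eqoP => eps eps0.
(* Once r^(s - sigma) exceeds [B], the surplus decay absorbs all constants and leaves [eps]. *)
pose B := expR 1 * (2 * C) / eps.
have B0 : 0 < B by rewrite divr_gt0// mulr_gt0 ?expR_gt0//; lra.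
pose M4 := Num.max M3 (Num.max N (Num.max `|c| (B `^ (s - sigma)^-1))).
exists M4; split; first exact: num_real.
move=> r; rewrite gt_max => /andP[M3r]; rewrite !gt_max => /and3P[Nr cr Br] rE.
have [Mr _ _ er] := M3P r (ltW M3r).
have r0 : 0 < r by lra.
apply: le_trans (proximity_shift_le Smaj (ltW cr)) _.
apply: le_trans (EN r (ltW Nr) rE) _.
have Tr0 : 0 < T r by have := TM r Mr; lra.
have rsig : 0 < r `^ sigma by rewrite powR_gt0.
rewrite ger0_norm; last by rewrite divr_ge0 ?ltW.
have Brs : B <= r `^ (s - sigma).
  have -> : B = (B `^ (s - sigma)^-1) `^ (s - sigma).
    by rewrite -powRrM mulVf ?powRr1 ?ltW// gt_eqF//; lra.
  rewrite ge0_ler_powR ?nnegrE ?powR_ge0 ?ltW//; lra.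
apply: (@le_trans _ _ (expR 1 * r `^ (- s) * (2 * C * T r))).
  by rewrite ler_wpM2l ?ST// mulr_ge0 ?expR_ge0 ?powR_ge0.
have -> : r `^ (- s) = (r `^ (s - sigma))^-1 / r `^ sigma.
  by rewrite -!powRN -powRD ?(gt_eqF r0) ?implybT//; congr (_ `^ _); ring.
have -> : expR 1 * ((r `^ (s - sigma))^-1 / r `^ sigma) * (2 * C * T r) =
    (expR 1 * (2 * C) / r `^ (s - sigma)) * (T r / r `^ sigma) by ring.
rewrite ler_wpM2r//; first by rewrite divr_ge0 ?ltW.
have X0 : 0 < r `^ (s - sigma) by rewrite powR_gt0.
by rewrite ler_pdivrMr// [leRHS]mulrC -ler_pdivrMr.
Qed.
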